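(* Let $n\ge 1$, $0<p<1$ and $0<q,\theta<\infty$. Assume that $u,w\in\mathcal W(0,\infty)$ and $v\in\mathcal W(\mathbb R^n)$. Then the following two statements are equivalent. (i) There exists a constant $C$ such that $$\bigg(\int_0^\infty\bigg(\int_{B(0,t)}f(s)^p v(s)\,ds\bigg)^{\frac qp}u(t)\,dt\bigg)^{\frac1q}\le C\bigg(\int_0^\infty\bigg(\int_{B(0,t)}f(s)\,ds\bigg)^{\theta}w(t)\,dt\bigg)^{\frac1\theta}$$ holds for every $f\in\mathcal M^+(\mathbb R^n)$. (ii) There exists a constant $C'$ such that $$\bigg(\int_0^\infty\bigg(\int_0^t g(s)^p\tilde v(s)\,ds\bigg)^{\frac qp}u(t)\,dt\bigg)^{\frac1q}\le C'\bigg(\int_0^\infty\bigg(\int_0^t g(s)\,ds\bigg)^{\theta}w(t)\,dt\bigg)^{\frac1\theta}$$ holds for every $g\in\mathcal M^+(0,\infty)$, where $$\tilde v(t):=\bigg(\int_{S^{n-1}}v(ts')^{\frac1{1-p}}\,d\sigma(s')\bigg)^{1-p}t^{(n-1)(1-p)}.$$ Moreover, the best (smallest) constants $C$ and $C'$ in these two inequalities satisfy $C=C'$.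
   Context: For a nonempty measurable set $A\subset\mathbb R^n$, $\mathcal M^+(A)$ denotes the set of nonnegative measurable functions on $A$, and $\mathcal W(A)$ the set of weights on $A$, i.e. measurable functions on $A$ that are positive and finite a.e.; for $A=(0,\infty)$ one writes $\mathcal M^+(0,\infty)$, $\mathcal W(0,\infty)$. $B(0,t)$ is the open ball in $\mathbb R^n$ centred at $0$ of radius $t$. $S^{n-1}=\{x\in\mathbb R^n:|x|=1\}$ is the unit sphere and $\sigma$ is the unique Borel measure on it such that $\int_{\mathbb R^n}f(x)\,dx=\int_0^\infty\int_{S^{n-1}}f(\tau x')\tau^{n-1}\,d\sigma(x')\,d\tau$ for every nonnegative Borel function $f$ on $\mathbb R^n$. *)

(* Defs.v *)
From HB Require Import structures.
From mathcomp Require Import all_boot all_order all_algebra.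
From mathcomp Require Import all_classical all_reals all_analysis.
From mathcomp Require Import measurable_realfun.

Set Implicit Arguments.
Unset Strict Implicit.
Unset Printing Implicit Defensive.

Import Order.TTheory GRing.Theory Num.Theory.
Import numFieldNormedType.Exports.

Local Open Scope classical_set_scope.
Local Open Scope ring_scope.

(* R^n is n.-tuple R with the product (= Borel) sigma-algebra. Its Lebesgue
   measure is built by induction on n: lambda_0 is the Dirac mass at the only
   point of R^0 and lambda_(n+1) is the image of lambda_1 \x lambda_n under
   (x, s) |-> x :: s. *)
Section lebesgue_Rn.
Context {R : realType}.
Local Open Scope ereal_scope.

Definition tcons n (y : measurableTypeR R * n.-tuple R) : n.+1.-tuple R :=
  [the n.+1.-tuple R of y.1 :: y.2].

Lemma measurable_tcons n : measurable_fun setT (@tcons n).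
Proof. exact: measurable_cons. Qed.

Section step.
Variables (n : nat) (m : {sigma_finite_measure set (n.-tuple R) -> \bar R}).

Definition lebesgue_step : set (n.+1.-tuple R) -> \bar R :=
  pushforward (@lebesgue_measure R \x m) (@tcons n).

Let step0 : lebesgue_step set0 = 0.
Proof. by rewrite /lebesgue_step /pushforward preimage_set0 measure0. Qed.

Let step_ge0 A : 0 <= lebesgue_step A.
Proof. by rewrite /lebesgue_step /pushforward; exact: measure_ge0. Qed.

Let step_sigma_additive : semi_sigma_additive lebesgue_step.
Proof.
move=> F mF tF mUF; rewrite /lebesgue_step /pushforward preimage_bigcup.
apply: measure_semi_sigma_additive.
- by move=> i; rewrite -[X in measurable X]setTI; exact: measurable_tcons.
- apply/trivIsetP => /= i j _ _ ij; rewrite -preimage_setI.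
  by move/trivIsetP : tF => /(_ _ _ _ _ ij) ->//; rewrite preimage_set0.
- by rewrite -preimage_bigcup -[X in measurable X]setTI; exact: measurable_tcons.
Qed.

HB.instance Definition _ := isMeasure.Build _ _ _
  lebesgue_step step0 step_ge0 step_sigma_additive.

Let sigma_finite_step : sigma_finite setT lebesgue_step.
Proof.
have /sigma_finiteP[F [UF ndF Foo]] := sigma_finiteT (@lebesgue_measure R).
have /sigma_finiteP[G [UG ndG Goo]] := sigma_finiteT m.
have mhead : measurable_fun setT (fun s : n.+1.-tuple R => thead s).
  exact: measurable_tnth.
have mtail := @measurable_behead _ R n.
exists (fun k => (fun s : n.+1.-tuple R => thead s) @^-1` F k `&`
                 (fun s : n.+1.-tuple R => [tuple of behead s]) @^-1` G k).
  apply/esym; rewrite -subTset => s _.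
  have [i _ Fi] : (\bigcup_i F i) (thead s) by rewrite -UF.
  have [j _ Gj] : (\bigcup_j G j) [tuple of behead s] by rewrite -UG.
  exists (maxn i j) => //; split.
    by have /subsetPset := ndF _ _ (leq_maxl i j); exact.
  by have /subsetPset := ndG _ _ (leq_maxr i j); exact.
move=> k; have [mF Fk] := Foo k; have [mG Gk] := Goo k; split.
  by apply: measurableI; rewrite -[X in measurable X]setTI;
    [exact: mhead|exact: mtail].
rewrite /lebesgue_step /pushforward (_ : _ @^-1` _ = F k `*` G k).
  by rewrite product_measure1E// lte_mul_pinfty// ge0_fin_numE.
apply/seteqP; split=> -[x y] /= [Fx Gy]; split=> //.
  by rewrite (_ : y = [tuple of behead (x :: y)])//; exact/val_inj.
by rewrite (_ : [tuple of behead (x :: y)] = y)//; exact/val_inj.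
Qed.

HB.instance Definition _ :=
  @Measure_isSigmaFinite.Build _ _ _ lebesgue_step sigma_finite_step.

End step.

Fixpoint lebesgue_Rn n : {sigma_finite_measure set (n.-tuple R) -> \bar R} :=
  match n with
  | 0 => \d_([tuple] : 0.-tuple R)
  | k.+1 => lebesgue_step (lebesgue_Rn k)
  end.

End lebesgue_Rn.

(* R and R^n with their Lebesgue, i.e. completed, sigma-algebras. Borel sets are
   those of R and n.-tuple R themselves. *)
Definition lebesgue_line (R : realType) :=
  caratheodory_type ((wlength (@idfun R))^*)%mu.

Definition lebesgue_space (n : nat) (R : realType) :=
  caratheodory_type ((@lebesgue_Rn R n)^*)%mu.

Definition completed_lebesgue_Rn {n : nat} {R : realType} :
    set (lebesgue_space n R) -> \bar R :=
  @completed_measure_extension _ (n.-tuple R) R (lebesgue_Rn n).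
HB.instance Definition _ n (R : realType) :=
  Measure.on (@completed_lebesgue_Rn n R).

Section classes.
Context d (T : measurableType d) (R : realType).
Local Open Scope ereal_scope.

Definition nonneg_measurable (A : set T) (f : T -> \bar R) :=
  measurable_fun A f /\ (forall x, A x -> 0 <= f x).

Definition weight (mu : {measure set T -> \bar R}) (A : set T)
    (w : T -> \bar R) :=
  measurable_fun A w /\ {ae mu, forall x, A x -> 0 < w x < +oo}.

End classes.

Section polar.
Context {R : realType} {n : nat}.
Implicit Types (x : n.-tuple R) (t : R).

Definition enorm x : R := Num.sqrt (\sum_(i < n) tnth x i ^+ 2).

Definition scale_Rn t x : n.-tuple R := [tuple t * tnth x i | i < n].

Definition open_ball0 t : set (n.-tuple R) := [set x | enorm x < t].

Definition unit_sphere : set (n.-tuple R) := [set x | enorm x = 1].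

(* A Borel measure on the sphere is encoded as a Borel measure on R^n that is
   carried by the sphere; the polar coordinates formula determines it. *)
Definition sphere_measure (sigma : {measure set (n.-tuple R) -> \bar R}) :=
  sigma (~` unit_sphere) = 0%E /\
  forall f : n.-tuple R -> \bar R, nonneg_measurable setT f ->
    (\int[lebesgue_Rn n]_x f x =
     \int[lebesgue_measure]_(t in `]0%R, +oo[)
       \int[sigma]_(s in unit_sphere) (f (scale_Rn t s) * (t ^+ n.-1)%:E))%E.

End polar.

Section hardy.
Context {R : realType} {n : nat}.
Variables p q theta : R.
Variables u w : lebesgue_line R -> \bar R.
Local Open Scope ereal_scope.

Definition ball_inequality (v : lebesgue_space n R -> \bar R) (C : R)
    (f : lebesgue_space n R -> \bar R) :=
  (\int[completed_lebesgue_measure]_(t in `]0%R, +oo[)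
     ((\int[completed_lebesgue_Rn]_(s in open_ball0 t) (f s `^ p * v s))
        `^ (q / p) * u t)) `^ q^-1 <=
  C%:E *
  (\int[completed_lebesgue_measure]_(t in `]0%R, +oo[)
     ((\int[completed_lebesgue_Rn]_(s in open_ball0 t) f s) `^ theta * w t))
    `^ theta^-1.

Definition line_inequality (v : lebesgue_line R -> \bar R) (C : R)
    (g : lebesgue_line R -> \bar R) :=
  (\int[completed_lebesgue_measure]_(t in `]0%R, +oo[)
     ((\int[completed_lebesgue_measure]_(s in `]0%R, t[) (g s `^ p * v s))
        `^ (q / p) * u t)) `^ q^-1 <=
  C%:E *
  (\int[completed_lebesgue_measure]_(t in `]0%R, +oo[)
     ((\int[completed_lebesgue_measure]_(s in `]0%R, t[) g s) `^ theta * w t))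
    `^ theta^-1.

(* Products use 0 * +oo = 0, so when the right-hand side is +oo for every
   f <> 0 the admissible constants are exactly the C > 0, with infimum 0. *)
Definition ball_constants (v : lebesgue_space n R -> \bar R) : set R :=
  [set C | (0 <= C)%R /\
    forall f : lebesgue_space n R -> \bar R,
      nonneg_measurable setT f -> ball_inequality v C f].

Definition line_constants (v : lebesgue_line R -> \bar R) : set R :=
  [set C | (0 <= C)%R /\
    forall g : lebesgue_line R -> \bar R,
      @nonneg_measurable _ (lebesgue_line R) R `]0%R, +oo[ g -> line_inequality v C g].

(* The inner integral is taken against the completion of sigma because
   s |-> v (t s) is sigma-measurable only up to null sets, for a.e. t. *)
Definition spherical_weight (sigma : {measure set (n.-tuple R) -> \bar R})
    (v : lebesgue_space n R -> \bar R) (t : lebesgue_line R) : \bar R :=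
  (\int[@completed_measure_extension _ (n.-tuple R) R sigma]_(s in unit_sphere)
     (v (scale_Rn t s) `^ (1 - p)^-1)) `^ (1 - p) *
  ((t : R) `^ (n.-1%:R * (1 - p)))%R%:E.

End hardy.

(* The infimum, +oo if there is no admissible constant. *)
Definition best_constant {R : realType} (A : set R) : \bar R :=
  ereal_inf (EFin @` A).

(* Main.v *)
Require Import Defs.
From HB Require Import structures.
From mathcomp Require Import all_boot all_order all_algebra.
From mathcomp Require Import all_classical all_reals all_analysis.
From mathcomp Require Import measurable_realfun.

(* The two inequalities have the same admissible constants. Write b for
   v ^ (1 / (1 - p)) and Phi(t) for its integral over the sphere of radius t.
   Given f, put g(t) = t ^ (n - 1) \int_S f(t s) ds: in polar coordinates the
   right-hand sides for f and g agree, and Hoelder's inequality on each sphere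
   bounds the left-hand side for f by the one for g. Conversely, given g, the
   equality case of Hoelder's inequality suggests
   f(x) = g(|x|) b(x) / (|x| ^ (n - 1) Phi(|x|)). As Phi may be infinite, v is
   replaced there by min(v, k), and k tends to infinity by monotone
   convergence. Lebesgue measurable functions are replaced by Borel ones, equal
   almost everywhere, so that Tonelli and polar coordinates apply. *)

Set Implicit Arguments.
Unset Strict Implicit.
Unset Printing Implicit Defensive.

Import Order.TTheory GRing.Theory Num.Theory.
Import numFieldNormedType.Exports.

Local Open Scope classical_set_scope.
Local Open Scope ring_scope.

(** * Completions of measures *)

(** The exponents in [spherical_weight] come from Hoelder's inequality with exponents 1/p and
    1/(1-p): in t^(n-1) = t^((n-1)p) t^((n-1)(1-p)) the first factor is absorbed by g^p and the
    second by the weight. All comparisons are made between inner integrals at a fixed t, so the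
    outer integrals enter only through monotonicity and monotone convergence. Each truncated
    extremal function has exactly g as its radial density, hence the same right-hand side for every
    k; this is why the passage to the limit costs nothing in the constant. Two points need care. A
    Lebesgue null set may contain whole spheres, so a Borel version of v has the right spherical
    integrals only for almost every radius. And dividing by the spherical integral requires it to be
    finite and positive, hence a sphere of finite nonzero mass, a fact extracted from the polar
    coordinates formula itself. *)

Section completion.
Local Open Scope ereal_scope.
Context d (X : measurableType d) d' (Y : measurableType d') (R : realType).
Variables (mu : {measure set X -> \bar R}) (nu : {measure set Y -> \bar R}).
Variable phi : Y -> X.

(* The Caratheodory types are aliases of the underlying types, so [phi] is the
   identity in the instances. *)
Record completion : Prop := Completion {
  completion_measurable : measurable_fun setT phi;
  completion_measure : forall A, measurable A -> nu (phi @^-1` A) = mu A;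
  completion_core : forall E, measurable E -> exists A,
    [/\ measurable A, phi @^-1` A `<=` E & nu.-negligible (E `\` phi @^-1` A)];
  completion_complete : measure_is_complete nu }.

Hypothesis C : completion.

Lemma completion_preimage A : measurable A -> measurable (phi @^-1` A).
Proof.
move=> mA; rewrite -[X in measurable X]setTI.
exact: (completion_measurable C).
Qed.

Lemma completion_measurable_fun d3 (Z : measurableType d3) (D : set X)
    (f : X -> Z) :
  measurable D -> measurable_fun D f -> measurable_fun (phi @^-1` D) (f \o phi).
Proof.
move=> mD mf _ B mB.
rewrite (_ : _ `&` _ = phi @^-1` (D `&` f @^-1` B))//.
by apply: completion_preimage; exact: mf.
Qed.

Lemma completion_integral D f : measurable D -> measurable_fun D f ->
    (forall x, D x -> 0 <= f x) ->
  \int[nu]_(y in phi @^-1` D) f (phi y) = \int[mu]_(x in D) f x.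
Proof.
move=> mD mf f0.
rewrite -(@ge0_integral_pushforward _ _ _ _ _ _ (completion_measurable C) nu D)//.
  apply: eq_measure_integral => [|mphi A mA _].
    exact: (completion_measurable C).
  by rewrite -(completion_measure C mA).
by move=> y; rewrite inE; exact: f0.
Qed.

Lemma completion_negligible N : mu.-negligible N -> nu.-negligible (phi @^-1` N).
Proof.
move=> [M [mM M0 NM]]; exists (phi @^-1` M); split.
- exact: completion_preimage.
- by rewrite (completion_measure C).
- by move=> x; exact: NM.
Qed.

Lemma completion_ae (P : X -> Prop) :
  {ae mu, forall x, P x} -> {ae nu, forall y, P (phi y)}.
Proof. by move/completion_negligible. Qed.

(* A nonnegative function is the supremum over the rationals [q >= 0] of
   [q * \1_{q < f}], and each level set can be replaced by its Borel core. *)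
Lemma completion_representative f : measurable_fun setT f ->
    (forall y, 0 <= f y) ->
  exists f' : X -> \bar R, [/\ measurable_fun setT f', forall x, 0 <= f' x
    & {ae nu, forall y, f y = f' (phi y)}].
Proof.
move=> mf f0.
(* [q] enumerates the nonnegative rationals: the absolute value removes signs, and codes of no
   rational give 0. *)
pose q k : R := `|ratr (odflt 0%R (unpickle k : option rat))|%R.
have qge0 k : (0 <= q k)%R by rewrite normr_ge0.
have mE k : measurable [set y | (q k)%:E < f y].
  by rewrite -[X in measurable X]setTI; exact: emeasurable_fun_o_infty.
pose A k := sval (cid (completion_core C (mE k))).
have Amea k : measurable (A k) by rewrite /A; case: cid => //= ? [].
have AE k : phi @^-1` (A k) `<=` [set y | (q k)%:E < f y].
  by rewrite /A; case: cid => //= ? [].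
have An k : nu.-negligible ([set y | (q k)%:E < f y] `\` phi @^-1` (A k)).
  by rewrite /A; case: cid => //= ? [].
pose h k x := (q k * \1_(A k) x)%R%:E.
have h0 k x : 0 <= h k x by rewrite lee_fin mulr_ge0.
exists (fun x => esups (h ^~ x) 0%N); split.
- apply: measurable_fun_esups => k; apply/measurable_EFinP.
  by apply: measurable_funM => //; exact: measurable_indic.
- move=> x; apply: (le_trans (h0 0%N x)).
  by apply: ereal_sup_ubound; exists 0%N.
have := negligible_bigcup An; apply: negligibleS => y /= neq.
apply: contrapT => yN; apply: neq.
have yA k : (q k)%:E < f y -> A k (phi y).
  by move=> qf; apply: contrapT => nA; apply: yN; exists k.
apply/eqP; rewrite eq_le; apply/andP; split; last first.
  apply: ub_ereal_sup => _ [k _ <-]; rewrite /h indicE.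
  have [|_] := boolP (phi y \in A k); last by rewrite mulr0 f0.
  by rewrite inE mulr1 => /AE /ltW.
have qsup k : (q k)%:E < f y -> (q k)%:E <= esups (h ^~ (phi y)) 0%N.
  move=> qf; apply: ereal_sup_ubound; exists k => //.
  by rewrite /h indicE mem_set ?mulr1//; exact: yA.
have sup0 : 0 <= esups (h ^~ (phi y)) 0%N.
  by apply: (le_trans (h0 0%N (phi y))); apply: ereal_sup_ubound; exists 0%N.
rewrite leNgt; apply/negP => lt_f.
set S := esups _ _ in qsup sup0 lt_f.
(* Since [f y] may be +oo, two reals [b < a] are inserted between [S] and [f y] before a rational is
   chosen between them. *)
have [a [aL aR]] : exists a : R, S < a%:E /\ a%:E < f y.
  case: S lt_f sup0 {qsup} => [s| |]//; last by rewrite ltNge leey.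
  case: (f y) => [b| |]// lt_f sup0.
    exists ((s + b) / 2)%R; rewrite !lte_fin; rewrite lte_fin in lt_f.
    by rewrite !midf_lt.
  by exists (s + 1)%R; rewrite ltry lte_fin ltrDl.
have [b [bL bR]] : exists b : R, S < b%:E /\ (b < a)%R.
  case: S aL sup0 {qsup lt_f} => [s| |]// aL _; rewrite lte_fin in aL.
  by exists ((s + a) / 2)%R; rewrite lte_fin !midf_lt.
have [r /andP[br ra]] := rat_in_itvoo bR.
have rq : exists k, q k = ratr r.
  exists (pickle r); rewrite /q pickleK /= ger0_norm// ltW// -(lte_fin 0).
  apply: (le_lt_trans sup0); apply: (lt_trans bL); by rewrite lte_fin.
have [k kr] := rq.
have qk : (q k)%:E < f y by apply: (lt_trans _ aR); rewrite kr lte_fin.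
have := qsup k qk; rewrite leNgt => /negP; apply.
by apply: (lt_trans bL); rewrite kr lte_fin.
Qed.

(** Measurability of [g] is a consequence: [nu] is complete, so agreeing almost everywhere with a
    measurable function is enough. *)
Lemma completion_integral_ae D (f : X -> \bar R) (g : Y -> \bar R) :
    measurable D -> measurable_fun D f -> (forall x, D x -> 0 <= f x) ->
    {ae nu, forall y, D (phi y) -> g y = f (phi y)} ->
  \int[nu]_(y in phi @^-1` D) g y = \int[mu]_(x in D) f x.
Proof.
move=> mD mf f0 gf; rewrite -completion_integral//.
have mD' := completion_preimage mD.
have mf' := completion_measurable_fun mD mf.
apply: ae_eq_integral => //.
apply: (ae_measurable_fun (completion_complete C) _ mf').
by apply: filterS gf => y + Dy => /(_ Dy) ->.
Qed.

End completion.

(** * Caratheodory completion of a sigma-finite measure *)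

Section completed_measure.
Local Open Scope ereal_scope.
Context d (T : measurableType d) (R : realType).
Variable mu : {measure set T -> \bar R}.
Notation cmu := (@completed_measure_extension _ T R mu).

Lemma completed_measureE (A : set T) : measurable A -> cmu A = mu A.
Proof. exact: measurable_mu_extE. Qed.

Lemma measurable_completed (A : set T) :
  measurable A -> measurable (A : set (caratheodory_type (mu^*)%mu)).
Proof. exact: caratheodory_measurable_mu_ext. Qed.

(** [cmu] is the outer measure, hence defined on every subset. The hull is an intersection of
    countable covers with excess below 1/(n+1); if the outer measure is infinite, the whole space
    serves. *)
Lemma completed_measure_hull (N : set T) :
  exists B, [/\ measurable B, N `<=` B & cmu N = mu B].
Proof.
have [Noo|Nfin] := eqVneq (cmu N) +oo.
  exists setT; split => //; apply/eqP; rewrite Noo eq_sym -leye_eq -Noo.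
  by rewrite -completed_measureE//; exact: le_outer_measure.
have {}Nfin : cmu N \is a fin_num.
  by rewrite ge0_fin_numE ?ltey//; exact: outer_measure_ge0.
have inv0 n : (0 < n.+1%:R^-1 :> R)%R by rewrite invr_gt0.
have cov n : exists B, [/\ measurable B, N `<=` B & mu B < cmu N + n.+1%:R^-1%:E].
  have [_ [F [mF NF] <-] lt] := lb_ereal_inf_adherent (inv0 n) Nfin.
  exists (\bigcup_k F k); split => //; first exact: bigcupT_measurable.
  apply: le_lt_trans lt; apply: measure_sigma_subadditive => //.
  exact: bigcupT_measurable.
pose B n := sval (cid (cov n)).
have BP n : [/\ measurable (B n), N `<=` B n & mu (B n) < cmu N + n.+1%:R^-1%:E].
  by rewrite /B; case: cid.
have mB : measurable (\bigcap_n B n).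
  by apply: bigcapT_measurable => n; case: (BP n).
exists (\bigcap_n B n); split => //.
  by move=> x Nx n _; case: (BP n) => _ /(_ x Nx).
apply/eqP; rewrite eq_le; apply/andP; split.
  rewrite -completed_measureE//; apply: le_outer_measure.
  by move=> x Nx n _; case: (BP n) => _ /(_ x Nx).
apply/lee_addgt0Pr => _/posnumP[e]; near \oo => n.
have [mBn _ /ltW ltn] := BP n.
apply: (@le_trans _ _ (mu (B n))).
  by apply: le_measure; rewrite ?inE//; exact: bigcap_inf.
apply: (le_trans ltn); rewrite leeD2l// lee_fin ltW//.
by near: n; exact: near_infty_natSinv_lt.
Unshelve. all: by end_near. Qed.

Lemma completed_measure_negligible (N : set T) :
  cmu.-negligible N -> mu.-negligible N.
Proof.
move=> [M [mM M0 NM]]; have [B [mB MB MBE]] := completed_measure_hull M.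
by exists B; split => //; [rewrite -MBE|exact: subset_trans MB].
Qed.

Lemma completion_completed_measure :
  sigma_finite setT mu -> completion mu cmu id.
Proof.
move=> [F FT Ffin]; split.
- by move=> _ A mA; rewrite setTI; exact: measurable_completed.
- exact: completed_measureE.
- move=> E mE.
  have mF k : measurable (F k) by case: (Ffin k).
  have mFc k := measurable_completed (mF k).
  pose D k := sval (cid (completed_measure_hull (F k `\` E))).
  have DP k : [/\ measurable (D k), F k `\` E `<=` D k &
      cmu (F k `\` E) = mu (D k)] by rewrite /D; case: cid.
  have mD k : measurable (D k) by case: (DP k).
  have mDc k := measurable_completed (mD k).
  (* The core is built from complements: inside [F k], remove a hull of the part outside [E]. As
     [F k] has finite measure, the excess of the hull can be computed by subtraction, and it is
     null. *)
  exists (\bigcup_k (F k `\` D k)); split.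
  + by apply: bigcupT_measurable => k; exact: measurableD.
  + move=> x [k _ [Fx Dx]]; apply: contrapT => Ex; apply: Dx.
    by case: (DP k) => _ + _; apply.
  + pose G k := (D k `\` (F k `\` E)).
    have : cmu.-negligible (\bigcup_k G k).
      apply: negligible_bigcup => k; exists (G k); split => //.
        by apply: measurableD => //; exact: measurableD.
      have [_ FD FDE] := DP k.
      rewrite measureD//; last 2 first.
        exact: measurableD.
        rewrite [ltLHS]completed_measureE// -FDE.
        apply: (@le_lt_trans _ _ (cmu (F k))).
          by apply: le_outer_measure; exact: subDsetl.
        by rewrite [ltLHS]completed_measureE//; case: (Ffin k).
      rewrite setIidr// [X in X - _]completed_measureE// [X in _ - X]FDE subee//.
      rewrite ge0_fin_numE// -FDE.
      apply: (@le_lt_trans _ _ (cmu (F k))).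
        by apply: le_outer_measure; exact: subDsetl.
      by rewrite [ltLHS]completed_measureE//; case: (Ffin k).
    apply: negligibleS => x [Ex nx].
    have [k _ Fx] : (\bigcup_k F k) x by rewrite -FT.
    exists k => //; split; last by case.
    by apply: contrapT => Dx; apply: nx; exists k.
- exact: measure_is_complete_caratheodory.
Qed.

End completed_measure.

Section instances.
Local Open Scope ereal_scope.
Context {R : realType}.

Lemma completion_line :
  completion (@lebesgue_measure R) completed_lebesgue_measure
    (id : lebesgue_line R -> measurableTypeR R).
Proof.
have sub (A : set (measurableTypeR R)) : measurable A ->
    measurable (A : set (lebesgue_line R)) by exact: sub_caratheodory.
split.
- by move=> _ A mA; rewrite setTI; exact: sub.
- by [].
- move=> E; rewrite /measurable/= => mE.
  have : (completed_algebra_gen (@lebesgue_measure R)).-sigma.-measurable E.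
    by rewrite completed_caratheodory_measurable.
  rewrite g_sigma_completed_algebra_genE => -[A mA [N [M [mM M0 NM]]] <-].
  exists A; split => //.
  exists M; split; [exact: sub|exact: M0|].
  by move=> x [[Ax|/NM]].
- exact: completed_lebesgue_measure_is_complete.
Qed.

Lemma completion_space n :
  completion (@lebesgue_Rn R n) completed_lebesgue_Rn
    (id : lebesgue_space n R -> n.-tuple R).
Proof. exact/completion_completed_measure/sigma_finiteT. Qed.

End instances.

(** * Polar coordinates *)

(** Tonelli measurability for a measure whose sigma-finiteness is a proved fact rather than part of
    its type; the structure is packed by hand. It serves for [sigma], whose sigma-finiteness follows
    from the polar formula. *)
Lemma measurable_fun_integral_section d1 d2 (T1 : measurableType d1)
    (T2 : measurableType d2) (R : realType)
    (m : {measure set T2 -> \bar R}) (D : set T2) (h : T1 * T2 -> \bar R) :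
  sigma_finite setT m -> measurable D -> measurable_fun setT h ->
  (forall z, 0 <= h z)%E ->
  measurable_fun setT (fun x => \int[m]_(y in D) h (x, y))%E.
Proof.
move=> sfm mD mh h0.
pose H1 := isSFinite.Build _ _ _ _ (sfinite_measure_sigma_finite sfm).
pose H2 := isSigmaFinite.Build _ _ _ _ sfm.
pose m' := HB.pack_for (SigmaFiniteMeasure.type T2 R) (Measure.sort m) H1 H2.
have mD' : measurable (setT `*` D : set (T1 * T2)) by exact: measurableX.
rewrite (_ : (fun x => _) = fubini_F m' (h \_ (setT `*` D))).
  apply: measurable_fun_fubini_tonelli_F.
    by apply/(measurable_restrictT _ mD'); exact: measurable_funTS.
  by move=> z; rewrite patchE; case: ifP.
apply/funext => x; rewrite /fubini_F integral_mkcond.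
by apply: eq_integral => y _; rewrite !patchE in_setX in_setT.
Qed.

Section geometry.
Context {R : realType} {n : nat}.
Implicit Types (x : n.-tuple R) (t : R).

Lemma measurable_enorm : measurable_fun setT (@enorm R n).
Proof.
apply: (@measurableT_comp _ _ _ _ _ _ (@Num.sqrt R)).
  by apply: continuous_measurable_fun; exact: sqrt_continuous.
by apply: measurable_sum => i; apply: measurable_funX; exact: measurable_tnth.
Qed.

Lemma measurable_unit_sphere : measurable (@unit_sphere R n).
Proof.
rewrite -[X in measurable X]setTI.
exact: (measurable_enorm measurableT (measurable_set1 1)).
Qed.

Lemma measurable_open_ball0 t : measurable (@open_ball0 R n t).
Proof.
rewrite /open_ball0 (_ : mkset _ = @enorm R n @^-1` `]-oo, t[).
  by rewrite -[X in measurable X]setTI; exact: measurable_enorm.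
by apply/seteqP; split => x; rewrite /= in_itv.
Qed.

Lemma measurable_scale_Rn :
  measurable_fun setT (fun z : R * n.-tuple R => scale_Rn z.1 z.2).
Proof.
apply/measurable_fun_tnthP => i.
rewrite (_ : _ \o _ = fun z => z.1 * tnth z.2 i); last first.
  by apply/funext => z; rewrite /= tnth_mktuple.
apply: measurable_funM => //.
by apply: (measurableT_comp (measurable_tnth _)).
Qed.

Lemma measurable_scale_Rnl t : measurable_fun setT (scale_Rn t : n.-tuple R -> _).
Proof.
apply: (measurableT_comp measurable_scale_Rn (g := fun x => (t, x))).
exact: measurable_pair1.
Qed.

Lemma enorm_scale_Rn t x : 0 <= t -> enorm (scale_Rn t x) = t * enorm x.
Proof.
move=> t0; rewrite /enorm; under eq_bigr do rewrite tnth_mktuple exprMn.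
by rewrite -mulr_sumr sqrtrM ?sqr_ge0// sqrtr_sqr ger0_norm.
Qed.

Lemma enorm_tnth x i : `|tnth x i| <= enorm x.
Proof.
rewrite -sqrtr_sqr ler_sqrt; last by apply: sumr_ge0 => j _; exact: sqr_ge0.
by rewrite (bigD1 i)//= lerDl; apply: sumr_ge0 => j _; exact: sqr_ge0.
Qed.

End geometry.

Section cube.
Context {R : realType}.

(** It contains the unit ball and has an elementary, finite and positive measure, so the sphere is
    shown to have finite nonzero mass without the volume of the ball. *)
Definition cube (n : nat) : set (n.-tuple R) := [set x | forall i, `|tnth x i| <= 1].
Arguments cube : clear implicits.

Lemma measurable_cube n : measurable (cube n).
Proof.
rewrite (_ : cube n =
    \bigcap_(i in [set: 'I_n]) (fun x => tnth x i) @^-1` `[-1, 1]).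
  apply: fin_bigcap_measurable => // i _; rewrite -[X in measurable X]setTI.
  exact: measurable_tnth.
apply/seteqP; split=> x xc i => [_|].
  by rewrite /= in_itv/= -ler_norml; exact: xc.
by have := xc i I; rewrite /= in_itv/= -ler_norml.
Qed.

Lemma lebesgue_Rn_cube n : lebesgue_Rn n (cube n) = (2 ^+ n)%:E.
Proof.
elim: n => [|n IH] /=.
  by rewrite /dirac indicE mem_set// => -[].
rewrite /lebesgue_step /pushforward.
rewrite (_ : _ @^-1` _ = `[-1, 1]%classic `*` cube n).
  rewrite product_measure1E//; last exact: measurable_cube.
  have e : lebesgue_measure (`[-1, 1]%classic : set R) = 2%:E.
    by rewrite lebesgue_measure_itv/= lte_fin gtrN// -EFinD opprK.
  by rewrite IH [X in (X * _)%E]e exprS.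
apply/seteqP; split => [[y x]/= h|[y x]/= [hy hx] i].
  split.
    by have := h ord0; rewrite tnth0/= in_itv/= ler_norml.
  by move=> i; have := h (lift ord0 i); rewrite tnthS.
case: (unliftP ord0 i) => [j ->|->]; first by rewrite tnthS.
by rewrite tnth0; move: hy; rewrite in_itv/= ler_norml.
Qed.

End cube.

Section polar_coordinates.
Local Open Scope ereal_scope.
Context {R : realType} {n : nat}.
Variable sigma : {measure set (n.-tuple R) -> \bar R}.
Hypothesis sphs : sphere_measure sigma.
Notation S := (@unit_sphere R n).
Let mS : measurable S := measurable_unit_sphere.
Implicit Type h : n.-tuple R -> \bar R.

Definition sphere_int h (t : R) := \int[sigma]_(s in S) h (scale_Rn t s).

Lemma sphere_int_ge0 h t : (forall x, 0 <= h x) -> 0 <= sphere_int h t.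
Proof. by move=> h0; exact: integral_ge0. Qed.

Lemma enorm_scale_sphere t s : (0 <= t)%R -> S s -> enorm (scale_Rn t s) = t.
Proof. by move=> t0 Ss; rewrite enorm_scale_Rn// Ss mulr1. Qed.

Lemma measurable_scaled h (t : R) : measurable_fun setT h ->
  measurable_fun setT (fun s => h (scale_Rn t s)).
Proof. by move=> mh; apply: measurableT_comp => //; exact: measurable_scale_Rnl. Qed.

Lemma polar_formula h : measurable_fun setT h -> (forall x, 0 <= h x) ->
  \int[lebesgue_Rn n]_x h x =
  \int[lebesgue_measure]_(t in `]0%R, +oo[) (sphere_int h t * (t ^+ n.-1)%:E).
Proof.
move=> mh h0; rewrite (sphs.2 h); last by split.
apply: eq_integral => t; rewrite inE/= in_itv/= andbT => t0.
rewrite ge0_integralZr//.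
- by apply: measurable_funTS; exact: measurable_scaled.
- by rewrite lee_fin exprn_ge0// ltW.
Qed.

(** Spheres of radius r >= t miss the ball and those of radius r < t lie in it, so restricting [h]
    to the ball amounts to restricting r. *)
Lemma polar_formula_ball h (t : R) : measurable_fun setT h -> (forall x, 0 <= h x) ->
  \int[lebesgue_Rn n]_(x in open_ball0 t) h x =
  \int[lebesgue_measure]_(r in `]0%R, t[) (sphere_int h r * (r ^+ n.-1)%:E).
Proof.
move=> mh h0; have mB := @measurable_open_ball0 R n t.
rewrite integral_mkcond polar_formula//; last 2 first.
- by apply/(measurable_restrictT _ mB); exact: measurable_funTS.
- by move=> x; rewrite patchE; case: ifP.
rewrite integral_mkcond [RHS]integral_mkcond; apply: eq_integral => r _.
rewrite !patchE; have [/set_mem|] := boolP (r \in `]0%R, +oo[%classic); last first.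
  rewrite notin_setE => r0; rewrite ifF//; apply/negP => /set_mem rt; apply: r0.
  by move: rt; rewrite /= !in_itv/= => /andP[->].
rewrite /= in_itv/= andbT => r0; have [rt|rt] := ltP r t.
  rewrite mem_set; last by rewrite /= in_itv/= r0.
  congr (_ * _); apply: eq_integral => s /set_mem Ss; rewrite patchE mem_set//.
  by rewrite /open_ball0/= enorm_scale_sphere// ltW.
rewrite ifF; last first.
  by apply/negP => /set_mem; rewrite /= in_itv/= r0/= ltNge rt.
rewrite /sphere_int integral0_eq ?mul0e// => s Ss; rewrite patchE ifF//.
apply/negP => /set_mem; rewrite /open_ball0/= enorm_scale_sphere//; last exact: ltW.
by rewrite ltNge rt.
Qed.

(** Infinite mass would give the unit ball infinite measure in polar coordinates, whereas it lies in
    a cube of measure 2^n. *)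
Lemma sphere_measure_fin : sigma S < +oo.
Proof.
rewrite ltey; apply/eqP => Soo.
have : \int[lebesgue_Rn n]_(x in open_ball0 1) 1%:E <= (2 ^+ n)%:E :> \bar R.
  rewrite -lebesgue_Rn_cube integral_cst ?mul1e//; last exact: measurable_open_ball0.
  apply: le_measure; rewrite ?inE;
    [exact: measurable_open_ball0|exact: measurable_cube|].
  by move=> x /= x1 i; apply: (le_trans (enorm_tnth x i)); exact: ltW.
rewrite (polar_formula_ball 1 (h := cst 1%:E))//; apply/negP; rewrite -ltNge.
rewrite (eq_integral (cst +oo)); last first.
  move=> r; rewrite inE/= in_itv/= => /andP[r0 r1].
  rewrite /sphere_int/= integral_cst// mul1e Soo gt0_mulye// lte_fin.
  exact: exprn_gt0.
rewrite integral_cst// gt0_mulye ?ltry//.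
by rewrite [ltRHS]lebesgue_measure_itv/= lte01 sube0 lte01.
Qed.

(** Mass zero would make the whole space Lebesgue null. *)
Lemma sphere_measure_gt0 : 0 < sigma S.
Proof.
rewrite lt0e measure_ge0 andbT; apply/eqP => S0.
have : (2 ^+ n)%:E <= \int[lebesgue_Rn n]_x 1%:E :> \bar R.
  rewrite -lebesgue_Rn_cube integral_cst ?mul1e//.
  by apply: le_measure; rewrite ?inE//; exact: measurable_cube.
rewrite (polar_formula (h := cst 1%:E))//; apply/negP; rewrite -ltNge.
rewrite integral0_eq ?lte_fin ?exprn_gt0// => r _.
by rewrite /sphere_int integral_cst// S0 mule0 mul0e.
Qed.

Lemma sphere_measure_sigma_finite : sigma_finite setT sigma.
Proof.
exists (fun k => if k is 0%N then S else ~` S).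
  apply/esym/seteqP; split=> // x _; have [Sx|Sx] := pselect (S x).
    by exists 0%N.
  by exists 1%N.
case=> [|k]; first by split => //; exact: sphere_measure_fin.
by split; [exact: measurableC|rewrite [ltLHS]sphs.1].
Qed.

Lemma measurable_sphere_int h : measurable_fun setT h -> (forall x, 0 <= h x) ->
  measurable_fun setT (sphere_int h).
Proof.
move=> mh h0; rewrite /sphere_int.
apply: (@measurable_fun_integral_section _ _ _ _ _ _ _
    (fun z => h (scale_Rn z.1 z.2))) => //.
  exact: sphere_measure_sigma_finite.
by apply: measurableT_comp => //; exact: measurable_scale_Rn.
Qed.

(** The polar formula for the indicator of a Borel null set containing [N] writes 0 as an integral
    over t. Its nonnegative integrand vanishes for almost every t, and the Jacobian is nonzero for t
    > 0. *)
Lemma sphere_negligible (N : set (n.-tuple R)) :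
  (lebesgue_Rn n).-negligible N ->
  {ae lebesgue_measure, forall t : measurableTypeR R, (0 < t)%R ->
    sigma.-negligible (S `&` [set s | N (scale_Rn t s)])}.
Proof.
move=> [M [mM M0 NM]].
pose h x : \bar R := (\1_M x)%:E.
have mh : measurable_fun setT h.
  by apply/measurable_EFinP; exact: measurable_indic.
have h0 x : 0 <= h x by rewrite lee_fin.
have mI : measurable_fun (`]0%R, +oo[%classic : set (measurableTypeR R))
    (fun t : R => sphere_int h t * (t ^+ n.-1)%:E).
  apply: emeasurable_funM.
    by apply: measurable_funTS; exact: measurable_sphere_int.
  by apply/measurable_EFinP; apply: measurable_funTS; exact: measurable_funX.
have /(ae_eq_integral_abs _ _ mI) : \int[lebesgue_measure]_(t in `]0%R, +oo[)
    `|sphere_int h t * (t ^+ n.-1)%:E| = 0.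
  under eq_integral => t.
    rewrite inE/= in_itv/= andbT => t0; rewrite gee0_abs; last first.
      by rewrite mule_ge0// ?sphere_int_ge0// lee_fin exprn_ge0// ltW.
    over.
  by rewrite -polar_formula// integral_indic// setIT.
move=> /(_ (measurable_itv _)); apply: filterS => t + t0.
rewrite /= in_itv/= t0 => /(_ isT)/eqP; rewrite mule_eq0 orbC eqe expf_eq0.
rewrite gt_eqF// andbF/= => /eqP I0.
pose M' := [set s | M (scale_Rn t s)].
have mM' : measurable M'.
  rewrite (_ : M' = setT `&` scale_Rn t @^-1` M); last by rewrite setTI.
  exact: measurable_scale_Rnl.
exists (S `&` M'); split.
- exact: measurableI.
- rewrite -I0 /sphere_int/h setIC -integral_indic//.
- by move=> s [Ss Ns]; split => //; exact: NM.
Qed.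

End polar_coordinates.

(** * Hoelder's inequality for exponents p and 1 - p *)

Section hoelder_concave.
Local Open Scope ereal_scope.
Context d (T : measurableType d) (R : realType) (mu : {measure set T -> \bar R}).
Variable p : R.
Hypotheses (p0 : (0 < p)%R) (p1 : (p < 1)%R).
Let q0 : (0 < 1 - p)%R. Proof. by rewrite subr_gt0. Qed.
Variables (D : set T) (mD : measurable D).

(** Young's inequality for x^p and y^(1-p) with conjugate exponents 1/p and 1/(1-p); an infinite
    argument makes the right-hand side infinite. *)
Lemma poweR_young (x y : \bar R) : 0 <= x -> 0 <= y ->
  x `^ p * y `^ (1 - p) <= p%:E * x + (1 - p)%:E * y.
Proof.
move: x y => [x| |] [y| |]//; rewrite ?lee_fin => x0 y0; last 3 first.
- by rewrite gt0_muley ?lte_fin// addey ?leey// -EFinM.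
- by rewrite [_%:E * +oo]gt0_muley ?lte_fin// addye ?leey// -EFinM.
- by rewrite [_%:E * +oo]gt0_muley ?lte_fin// addye ?leey// gt0_muley ?lte_fin.
have := @conjugate_powR R (x `^ p)%R (y `^ (1 - p))%R p^-1%R (1 - p)^-1%R.
rewrite !powR_ge0 !invr_gt0 p0 q0 !invrK (addrC p) subrK.
move=> /(_ isT isT isT isT erefl).
rewrite -!powRrM !mulfV ?gt_eqF// !powRr1// => h.
by rewrite (mulrC p) (mulrC (1 - p)%R).
Qed.

(** [a] vanishes almost everywhere, and 0 * +oo = 0 makes the product vanish there even where [b] is
    infinite. *)
Lemma integral_poweR_eq0 (a b : T -> \bar R) (r : R) : (0 < r)%R ->
  measurable_fun D a -> measurable_fun D b ->
  (forall x, 0 <= a x) -> \int[mu]_(x in D) a x = 0 ->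
  \int[mu]_(x in D) (a x `^ r * b x) = 0.
Proof.
move=> r0 ma mb a0 A0.
have : ae_eq mu D a (cst 0).
  apply/ae_eq_integral_abs => //; rewrite -A0.
  by apply: eq_integral => x _; rewrite gee0_abs.
move=> ae0; rewrite (ae_eq_integral (cst 0)) ?integral0//.
  apply: emeasurable_funM => //.
  exact: (measurableT_comp (measurable_poweR _)).
by apply: filterS ae0 => x + Dx => /(_ Dx) ->; rewrite poweR0r ?gt_eqF// mul0e.
Qed.

(** Young's inequality is integrated after dividing [a] and [b] by their integrals. If one of these
    is zero, the left-hand side vanishes; otherwise, if one is infinite, so is the right-hand
    side. *)
Lemma integral_poweR_hoelder (a b : T -> \bar R) :
  measurable_fun D a -> measurable_fun D b ->
  (forall x, 0 <= a x) -> (forall x, 0 <= b x) ->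
  \int[mu]_(x in D) (a x `^ p * b x `^ (1 - p)) <=
  (\int[mu]_(x in D) a x) `^ p * (\int[mu]_(x in D) b x) `^ (1 - p).
Proof.
move=> ma mb a0 b0.
have map : measurable_fun D (fun x => a x `^ p).
  exact: (measurableT_comp (measurable_poweR _)).
have mbp : measurable_fun D (fun x => b x `^ (1 - p)).
  exact: (measurableT_comp (measurable_poweR _)).
have A0 : 0 <= \int[mu]_(x in D) a x by exact: integral_ge0.
have B0 : 0 <= \int[mu]_(x in D) b x by exact: integral_ge0.
have [A00|An0] := eqVneq (\int[mu]_(x in D) a x) 0.
  by rewrite integral_poweR_eq0// mule_ge0// poweR_ge0.
have [B00|Bn0] := eqVneq (\int[mu]_(x in D) b x) 0.
  under eq_integral do rewrite muleC.
  by rewrite integral_poweR_eq0// mule_ge0// poweR_ge0.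
have Agt0 : 0 < \int[mu]_(x in D) a x by rewrite lt0e An0.
have Bgt0 : 0 < \int[mu]_(x in D) b x by rewrite lt0e Bn0.
have [Aoo|Afin] := eqVneq (\int[mu]_(x in D) a x) +oo.
  by rewrite Aoo poweRyr ?gt_eqF// gt0_mulye ?leey// poweR_gt0.
have [Boo|Bfin] := eqVneq (\int[mu]_(x in D) b x) +oo.
  by rewrite Boo poweRyr ?gt_eqF// gt0_muley ?leey// poweR_gt0.
have [A AE] : exists A, \int[mu]_(x in D) a x = A%:E.
  by exists (fine (\int[mu]_(x in D) a x)); rewrite fineK// ge0_fin_numE// ltey.
have [B BE] : exists B, \int[mu]_(x in D) b x = B%:E.
  by exists (fine (\int[mu]_(x in D) b x)); rewrite fineK// ge0_fin_numE// ltey.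
rewrite AE lte_fin in Agt0; rewrite BE lte_fin in Bgt0.
pose c := (A `^ p * B `^ (1 - p))%R.
have cgt0 : (0 < c)%R by rewrite mulr_gt0// powR_gt0.
have scale x : a x `^ p * b x `^ (1 - p) =
    c%:E * ((A^-1%:E * a x) `^ p * (B^-1%:E * b x) `^ (1 - p)).
  rewrite !poweRM ?lee_fin ?invr_ge0 ?(ltW Agt0) ?(ltW Bgt0)//.
  have e : (c * (A^-1 `^ p * B^-1 `^ (1 - p)) = 1)%R.
    rewrite /c mulrACA -!powRM ?invr_ge0 ?ltW//.
    by rewrite !mulfV ?gt_eqF// !powR1 mulr1.
  by rewrite [X in _ = _ * X]muleACA !poweR_EFin -EFinM [RHS]muleA -EFinM e mul1e.
rewrite AE BE !poweR_EFin -EFinM -/c.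
apply: (@le_trans _ _ (\int[mu]_(x in D)
    (c%:E * (p%:E * (A^-1%:E * a x) + (1 - p)%:E * (B^-1%:E * b x))))).
  apply: ge0_le_integral => //.
  - by move=> x _; rewrite mule_ge0// poweR_ge0.
  - exact: emeasurable_funM.
  - apply: emeasurable_funM => //; apply: emeasurable_funD;
      apply: emeasurable_funM => //; exact: emeasurable_funM.
  - move=> x _; rewrite scale lee_pmul2l ?lte_fin//.
    by apply: poweR_young; rewrite mule_ge0// lee_fin invr_ge0 ltW.
have mAa : measurable_fun D (fun x => A^-1%:E * a x) by exact: emeasurable_funM.
have mBb : measurable_fun D (fun x => B^-1%:E * b x) by exact: emeasurable_funM.
have Aa0 x : 0 <= A^-1%:E * a x by rewrite mule_ge0// lee_fin invr_ge0 ltW.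
have Bb0 x : 0 <= B^-1%:E * b x by rewrite mule_ge0// lee_fin invr_ge0 ltW.
rewrite ge0_integralZl//; last 3 first.
- by apply: emeasurable_funD; exact: emeasurable_funM.
- by move=> x _; rewrite adde_ge0// mule_ge0// lee_fin ltW.
- by rewrite lee_fin ltW.
rewrite ge0_integralD//; last 4 first.
- by move=> x _; rewrite mule_ge0// lee_fin ltW.
- exact: emeasurable_funM.
- by move=> x _; rewrite mule_ge0// lee_fin ltW.
- exact: emeasurable_funM.
rewrite !ge0_integralZl ?lee_fin ?invr_ge0 ?(ltW p0) ?(ltW q0) ?(ltW Agt0)
  ?(ltW Bgt0)//.
by rewrite AE BE -!EFinM !mulVf ?gt_eqF// !mulr1 (addrC p) subrK mulr1.
Qed.

End hoelder_concave.

(** * Monotone limits *)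

Section monotone_limits.
Local Open Scope ereal_scope.
Context {R : realType}.
Implicit Types (x : (\bar R)^nat) (a l : \bar R) (r : R).

Lemma le_poweR (y z : \bar R) r : (0 < r)%R -> 0 <= y -> y <= z ->
  y `^ r <= z `^ r.
Proof.
move=> r0 y0 yz; apply: gt0_ler_poweR => //; first exact: ltW.
- by rewrite in_itv/= y0 leey.
- by rewrite in_itv/= (le_trans y0 yz) leey.
Qed.

Lemma nondecreasing_cvge_le x l : nondecreasing_seq x ->
  x k @[k --> \oo] --> l -> forall k, x k <= l.
Proof.
move=> ndx xl k; apply: (cvge_to_ge xl); exists k => // m /= km.
exact: ndx.
Qed.

(** The limit L of the powers exists by monotonicity and is at most l^r. Conversely x_k <= L^(1/r)
    for all k, so l <= L^(1/r); this covers l = +oo as well. *)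
Lemma cvg_poweR_nondecreasing x l r : (0 < r)%R -> (forall k, 0 <= x k) ->
  nondecreasing_seq x -> x k @[k --> \oo] --> l ->
  x k `^ r @[k --> \oo] --> l `^ r.
Proof.
move=> r0 x0 ndx xl.
have ndxr : nondecreasing_seq (fun k => x k `^ r).
  by move=> m n mn; apply: le_poweR => //; exact: ndx.
have xle := nondecreasing_cvge_le ndx xl.
have l0 : 0 <= l := le_trans (x0 0%N) (xle 0%N).
have cvgr := ereal_nondecreasing_is_cvgn ndxr.
suff -> : l `^ r = limn (fun k => x k `^ r) by exact: cvgr.
have lim0 : 0 <= limn (fun k => x k `^ r).
  by apply: lime_ge => //; apply: nearW => k; exact: poweR_ge0.
apply/eqP; rewrite eq_le; apply/andP; split; last first.
  by apply: lime_le => //; apply: nearW => k; exact: le_poweR.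
have : l <= (limn (fun k => x k `^ r)) `^ r^-1.
  apply: (cvge_to_le xl); apply: nearW => k.
  rewrite -[leLHS](poweRe1 (x0 k)) -(@mulfV _ r) ?gt_eqF//.
  rewrite poweRrM; apply: le_poweR; rewrite ?invr_gt0 ?poweR_ge0//.
  exact: (nondecreasing_cvge_le ndxr).
move=> /(le_poweR r0 l0); rewrite -poweRrM mulVf ?gt_eqF// poweRe1//.
Qed.

(** For [a] = +oo multiplication is discontinuous at 0, but monotonicity leaves two cases: every x_k
    is 0, or the products are eventually +oo. *)
Lemma cvgeMl_nondecreasing a x l : 0 <= a -> (forall k, 0 <= x k) ->
  nondecreasing_seq x -> x k @[k --> \oo] --> l ->
  a * x k @[k --> \oo] --> a * l.
Proof.
case: a => [a| |]// a0 x0 ndx xl; first exact: cvgeZl.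
have [x00|/existsNP[k /eqP xk0]] := pselect (forall k, x k = 0).
  have -> : l = 0.
    apply/eqP; rewrite eq_le; apply/andP; split.
      by apply: (cvge_to_le xl); apply: nearW => k; rewrite x00.
    by apply: (cvge_to_ge xl); exact: nearW.
  rewrite (_ : (fun k => _) = cst (+oo * 0)); first exact: cvg_cst.
  by apply/funext => k; rewrite x00.
have xk : 0 < x k by rewrite lt0e xk0 x0.
rewrite gt0_mulye; last by rewrite (lt_le_trans xk)//; exact: nondecreasing_cvge_le.
apply: cvg_near_cst; exists k => // m /= km.
by rewrite gt0_mulye// (lt_le_trans xk)//; exact: ndx.
Qed.

(** Superlevel sets of a monotone function are intervals. This gives the measurability of the inner
    integrals as functions of their upper limit. *)
Lemma nondecreasing_emeasurable (F : R -> \bar R) :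
  {homo F : s t / (s <= t)%R >-> s <= t} ->
  measurable_fun (setT : set (measurableTypeR R)) F.
Proof.
move=> ndF; apply: (measurability _ (ErealGenOInfty.measurableE R)) => //.
move=> _ [_ [x ->] <-]; rewrite setTI; apply: is_interval_measurable.
move=> s t/=; rewrite !in_itv/= !andbT => Fs Ft y /andP[sy yt].
by rewrite in_itv/= andbT (lt_le_trans Fs)// ndF.
Qed.

End monotone_limits.

(** * Outer integrals against a weight *)

Section weighted_integral.
Local Open Scope ereal_scope.
Context d (T : measurableType d) (R : realType).
Variables (mu : {measure set T -> \bar R}) (D : set T).
Variables (u : T -> \bar R) (r : R).
Hypotheses (mD : measurable D) (wu : weight mu D u) (r0 : (0 < r)%R).
Implicit Types F G : T -> \bar R.

Definition weighted_integral F := \int[mu]_(t in D) (F t `^ r * u t).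

(** A version of [u], equal to it almost everywhere on [D], that is nonnegative and finite
    everywhere: nonnegativity gives monotonicity of the integrand, finiteness its continuity along
    limits. *)
Let u0 t : \bar R := (Num.max (fine (u t)) 0)%:E.

Let u0_ge0 t : 0 <= u0 t. Proof. by rewrite lee_fin le_max lexx orbT. Qed.

Let mu0 : measurable_fun D u0.
Proof.
apply/measurable_EFinP; apply: measurable_maxr => //.
by apply: measurableT_comp => //; exact: wu.1.
Qed.

Let measurable_powerR F : measurable_fun D F ->
  measurable_fun D (fun t => F t `^ r).
Proof. exact: (measurableT_comp (measurable_poweR _)). Qed.

Let weighted_integralE F : measurable_fun D F ->
  weighted_integral F = \int[mu]_(t in D) (F t `^ r * u0 t).
Proof.
move=> mF; apply: ae_eq_integral => //.
- by apply: emeasurable_funM; [exact: measurable_powerR|exact: wu.1].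
- by apply: emeasurable_funM => //; exact: measurable_powerR.
apply: filterS wu.2 => t + Dt => /(_ Dt)/andP[ut ufin]; congr (_ * _).
rewrite /u0 max_l; last by rewrite fine_ge0// ltW.
by rewrite fineK// ge0_fin_numE// ltW.
Qed.

Lemma weighted_integral_ge0 F : measurable_fun D F -> 0 <= weighted_integral F.
Proof.
move=> mF; rewrite weighted_integralE//; apply: integral_ge0 => t _.
by rewrite mule_ge0// poweR_ge0.
Qed.

Lemma le_weighted_integral F G : measurable_fun D F -> measurable_fun D G ->
  (forall t, 0 <= F t) -> (forall t, F t <= G t) ->
  weighted_integral F <= weighted_integral G.
Proof.
move=> mF mG F0 FG; rewrite !weighted_integralE//.
apply: ge0_le_integral => //.
- by move=> t _; rewrite mule_ge0// poweR_ge0.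
- by apply: emeasurable_funM => //; exact: measurable_powerR.
- by apply: emeasurable_funM => //; exact: measurable_powerR.
- by move=> t _; apply: lee_wpmul2r => //; exact: le_poweR.
Qed.

(** Monotone convergence, stated for an upper bound because the truncation argument supplies the
    same bound for every k. *)
Lemma weighted_integral_lim_le (F : (T -> \bar R)^nat) G (B : \bar R) :
  (forall k, measurable_fun D (F k)) -> measurable_fun D G ->
  (forall k t, 0 <= F k t) ->
  (forall t, nondecreasing_seq (F ^~ t)) ->
  (forall t, F k t @[k --> \oo] --> G t) ->
  (forall k, weighted_integral (F k) <= B) ->
  weighted_integral G <= B.
Proof.
move=> mF mG F0 ndF FG FB; rewrite weighted_integralE//.
have FuG t : F k t `^ r * u0 t @[k --> \oo] --> G t `^ r * u0 t.
  by apply: cvgeZr => //; exact: cvg_poweR_nondecreasing.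
rewrite (eq_integral (fun t => limn (fun k => F k t `^ r * u0 t))); last first.
  by move=> t _; rewrite (cvg_lim _ (FuG t)).
have mFu k : measurable_fun D (fun t => F k t `^ r * u0 t).
  by apply: emeasurable_funM => //; exact: measurable_powerR.
have nd t : nondecreasing_seq (fun k => F k t `^ r * u0 t).
  by move=> m k mk; apply: lee_wpmul2r => //; apply: le_poweR => //; exact: ndF.
rewrite monotone_convergence//; last first.
  by move=> k t _; rewrite mule_ge0// poweR_ge0.
apply: lime_le.
  apply: ereal_nondecreasing_is_cvgn => m k mk.
  apply: ge0_le_integral => //; first by move=> t _; rewrite mule_ge0// poweR_ge0.
  by move=> t _; exact: nd.
by apply: nearW => k; rewrite -weighted_integralE.
Qed.

End weighted_integral.

(** * Radial reduction *)

Section radial_reduction.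
Local Open Scope ereal_scope.
Context {R : realType} {n : nat}.
Variables (p : R) (sigma : {measure set (n.-tuple R) -> \bar R}).
Hypotheses (p0 : (0 < p)%R) (p1 : (p < 1)%R).
Hypothesis sphs : sphere_measure sigma.
Notation S := (@unit_sphere R n).
Let mS : measurable S := measurable_unit_sphere.
Let q0 : (0 < 1 - p)%R. Proof. by rewrite subr_gt0. Qed.

(** [spherical_weight] in terms of b = v^(1/(1-p)), real and defined everywhere, so that truncations
    of v can be substituted for v. *)
Definition radial_weight (b : n.-tuple R -> R) (t : R) : \bar R :=
  sphere_int sigma (EFin \o b) t `^ (1 - p) *
  (t `^ (n.-1%:R * (1 - p)))%R%:E.

Lemma radial_weight_ge0 b t : 0 <= radial_weight b t.
Proof. by rewrite mule_ge0 ?poweR_ge0// lee_fin powR_ge0. Qed.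

Lemma measurable_radial_weight (b : n.-tuple R -> R) : measurable_fun setT b ->
  (forall x, 0 <= b x)%R ->
  measurable_fun (setT : set (measurableTypeR R)) (radial_weight b).
Proof.
move=> mb b0; apply: emeasurable_funM.
  apply: (measurableT_comp (measurable_poweR _)).
  by apply: measurable_sphere_int => //; exact/measurable_EFinP.
by apply/measurable_EFinP; exact: measurable_powR.
Qed.

Lemma weight_representative (v : lebesgue_space n R -> \bar R) :
  weight completed_lebesgue_Rn setT v -> exists vr : n.-tuple R -> R,
  [/\ measurable_fun setT vr, forall x, (0 < vr x)%R
    & {ae completed_lebesgue_Rn, forall x : lebesgue_space n R, v x = (vr x)%:E}].
Proof.
move=> [mv v0].
have [v' [mv' v'0 vv']] := completion_representative (completion_space n)
  (measurable_funepos mv) (funepos_ge0 v).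
(* The value 1 where v' is 0 or +oo makes the representative positive and finite everywhere; this
   changes v' only on a null set, as v is a weight. *)
exists (fun x => if (0 < fine (v' x))%R then fine (v' x) else 1%R); split.
- have mf : measurable_fun setT (fine \o v') by exact: measurableT_comp.
  apply: measurable_fun_ifT => //.
  by apply: measurable_fun_ltr.
- by move=> x; case: ifP.
apply: filterS2 v0 vv' => x /(_ I)/andP[vgt0 vfin].
rewrite funeposE max_l ?ltW// => <-.
by rewrite fine_gt0 ?vgt0// fineK// ge0_fin_numE// ltW.
Qed.

(** The set where v differs from its Borel version is Lebesgue null, so almost every sphere meets it
    in a [sigma]-null set, invisible to the completion of [sigma]. *)
Lemma spherical_weightE (v : lebesgue_space n R -> \bar R) (vr : n.-tuple R -> R) :
  measurable_fun setT vr -> (forall x, 0 < vr x)%R ->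
  {ae completed_lebesgue_Rn, forall x : lebesgue_space n R, v x = (vr x)%:E} ->
  {ae lebesgue_measure, forall t : measurableTypeR R, (0 < t)%R ->
    spherical_weight p sigma v t =
    radial_weight (fun x => (vr x `^ (1 - p)^-1)%R) t}.
Proof.
move=> mvr vr0 /completed_measure_negligible/(sphere_negligible sphs).
apply: filterS => t + t0 => /(_ t0) neg.
congr (_ `^ _ * _).
have C := completion_completed_measure (sphere_measure_sigma_finite sphs).
apply: (completion_integral_ae C
  (f := fun s => (vr (scale_Rn t s) `^ (1 - p)^-1)%R%:E)) => //.
- apply/measurable_EFinP.
  apply: (@measurableT_comp _ _ _ _ _ _ (@powR R ^~ _)).
    exact: measurable_powR.
  apply: measurable_funTS; apply: measurableT_comp => //.
  exact: measurable_scale_Rnl.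
- by move=> x _; rewrite lee_fin powR_ge0.
have := completion_negligible C neg; apply: negligibleS => s /= /not_implyP[Ss ne].
split => // vE; apply: ne; by rewrite vE.
Qed.

Let powR_jacobian (t : R) : (0 < t)%R ->
  ((t ^+ n.-1) `^ (1 - p))%R = (t `^ (n.-1%:R * (1 - p)))%R.
Proof. by move=> t0; rewrite powRrM powR_mulrn// ltW. Qed.

Let powR_split (x : R) : (0 < x)%R -> (x `^ p * x `^ (1 - p))%R = x.
Proof.
move=> x0; rewrite -powRD ?(gt_eqF x0) ?implybT// addrC subrK powRr1//.
exact: ltW.
Qed.

Let powR_invM (x : R) : (0 < x)%R -> (x^-1 `^ p * x)%R = (x `^ (1 - p))%R.
Proof.
move=> x0; rewrite -[X in (_ * X)%R = _](powR_split x0) mulrA.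
by rewrite -powRM ?invr_ge0 ?(ltW x0)// mulVf ?gt_eqF// powR1 mul1r.
Qed.

Lemma sphere_hoelder (f : n.-tuple R -> \bar R) (vr : n.-tuple R -> R) (t : R) :
  measurable_fun setT f -> (forall x, 0 <= f x) ->
  measurable_fun setT vr -> (forall x, 0 < vr x)%R -> (0 < t)%R ->
  sphere_int sigma (fun x => f x `^ p * (vr x)%:E) t * (t ^+ n.-1)%:E <=
  (sphere_int sigma f t * (t ^+ n.-1)%:E) `^ p *
  radial_weight (fun x => (vr x `^ (1 - p)^-1)%R) t.
Proof.
move=> mf f0 mvr vr0 t0.
have T0 : (0 < t ^+ n.-1)%R by exact: exprn_gt0.
have A0 := sphere_int_ge0 sigma t f0.
rewrite poweRM//; last by rewrite lee_fin ltW.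
rewrite /radial_weight muleACA -powR_jacobian// poweR_EFin -EFinM.
rewrite powR_split//; apply: lee_wpmul2r; first by rewrite lee_fin ltW.
have -> : sphere_int sigma (fun x => f x `^ p * (vr x)%:E) t =
    \int[sigma]_(s in S) (f (scale_Rn t s) `^ p *
      (vr (scale_Rn t s) `^ (1 - p)^-1)%R%:E `^ (1 - p)).
  apply: eq_integral => s _; congr (_ * _); rewrite poweR_EFin -powRrM.
  by rewrite mulVf ?gt_eqF// powRr1// ltW.
apply: (@integral_poweR_hoelder _ _ _ sigma p p0 p1 S mS
  (fun s => f (scale_Rn t s)) (fun s => (vr (scale_Rn t s) `^ (1 - p)^-1)%:E)) => //.
- by apply: measurable_funTS; exact: measurable_scaled.
- apply/measurable_EFinP.
  apply: (@measurableT_comp _ _ _ _ _ _ (@powR R ^~ _)).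
    exact: measurable_powR.
  apply: measurable_funTS; apply: measurableT_comp => //.
  exact: measurable_scale_Rnl.
- by move=> x; rewrite lee_fin powR_ge0.
Qed.

(* Equality case of Hoelder's inequality on each sphere. *)
Definition radial_extremal (g : R -> \bar R) (b : n.-tuple R -> R) x : \bar R :=
  g (enorm x) * (b x / (enorm x ^+ n.-1 *
    fine (sphere_int sigma (EFin \o b) (enorm x))))%R%:E.

Section extremal.
Variables (g : R -> \bar R) (b : n.-tuple R -> R) (K : R).
Hypotheses (mg : measurable_fun (setT : set (measurableTypeR R)) g).
Hypotheses (g0 : forall t, 0 <= g t) (mb : measurable_fun setT b).
Hypotheses (b0 : forall x, (0 < b x)%R) (bK : forall x, (b x <= K)%R).

Let Phi := sphere_int sigma (EFin \o b).
Let b0' x : 0 <= (EFin \o b) x. Proof. by rewrite lee_fin ltW. Qed.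
Let mb' : measurable_fun setT (EFin \o b). Proof. exact/measurable_EFinP. Qed.

Lemma measurable_radial_extremal : measurable_fun setT (radial_extremal g b).
Proof.
have mPhi := measurable_sphere_int sphs mb' b0'.
apply: emeasurable_funM.
  by apply: (measurableT_comp mg); exact: measurable_enorm.
apply/measurable_EFinP; apply: measurable_funM => //.
(* The inverse of a nonnegative real is its power -1, and real powers are measurable. *)
rewrite (_ : (fun _ => _) = (fun x => (enorm x ^+ n.-1 *
    fine (sphere_int sigma (EFin \o b) (enorm x))) `^ (-1))%R); last first.
  apply/funext => x; rewrite powR_inv1// mulr_ge0 ?exprn_ge0 ?sqrtr_ge0//.
  by rewrite fine_ge0// sphere_int_ge0.
apply: (@measurableT_comp _ _ _ _ _ _ (@powR R ^~ _)).
  exact: measurable_powR.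
apply: measurable_funM; first by apply: measurable_funX; exact: measurable_enorm.
apply: measurableT_comp => //.
by apply: (measurableT_comp mPhi); exact: measurable_enorm.
Qed.

Lemma radial_extremal_ge0 x : 0 <= radial_extremal g b x.
Proof.
rewrite mule_ge0// lee_fin divr_ge0//; first exact: ltW.
by rewrite mulr_ge0 ?exprn_ge0 ?sqrtr_ge0// fine_ge0// sphere_int_ge0.
Qed.

(** Finiteness combines the bound [K] with the finite mass of the sphere; positivity combines
    [0 < b] with its nonzero mass. *)
Let Phi_fin t : exists r : R, (0 < r)%R /\ Phi t = r%:E.
Proof.
have mbt : measurable_fun S (fun s => (b (scale_Rn t s))%:E).
  by apply: measurable_funTS; exact: (@measurable_scaled _ _ (EFin \o b) t mb').
have Phi0 : 0 <= Phi t by exact: sphere_int_ge0.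
have Pfin : Phi t < +oo.
  apply: (@le_lt_trans _ _ (\int[sigma]_(s in S) K%:E)).
    apply: ge0_le_integral => //.
    move=> s _; exact: bK.
  (* Any point yields [0 <= K] from [0 < b x <= K]. *)
  have [x _] : exists x : n.-tuple R, True by exists [tuple 0%R | i < n].
  rewrite integral_cst//; have := sphere_measure_fin sphs.
  by move=> fin; rewrite lte_mul_pinfty// lee_fin (le_trans _ (bK x))// ltW.
have Pn0 : Phi t != 0.
  apply/eqP => P0.
  have : ae_eq sigma S (fun s => (b (scale_Rn t s))%:E) (cst 0).
    apply/(ae_eq_integral_abs sigma mS mbt); rewrite -P0.
    apply: eq_integral => s _; rewrite gee0_abs//; exact: b0'.
  move=> /(measure_negligible _); have := sphere_measure_gt0 sphs.
  rewrite (_ : ~` _ = S); first by move=> + /(_ mS) => /[swap] ->; rewrite ltxx.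
  apply/seteqP; split=> s /=; first by move/not_implyP => [].
  by move=> Ss /(_ Ss)[] /eqP; rewrite gt_eqF.
exists (fine (Phi t)); rewrite fineK ?ge0_fin_numE//; split => //.
by rewrite fine_gt0// Pfin lt0e Pn0 Phi0.
Qed.

Lemma radial_extremal_scaled (t : R) s : (0 < t)%R -> S s ->
  radial_extremal g b (scale_Rn t s) =
  g t * ((t ^+ n.-1 * fine (Phi t))^-1 * b (scale_Rn t s))%R%:E.
Proof.
move=> t0 Ss; rewrite /radial_extremal (enorm_scale_sphere (ltW t0) Ss).
by rewrite [(_ * b _)%R]mulrC.
Qed.

(** The norm is constant on the sphere, so the integral of [b] cancels [Phi t] and the Jacobian
    cancels the power of t. Hence the extremal function and [g] have the same right-hand side. *)
Lemma sphere_int_radial_extremal (t : R) : (0 < t)%R ->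
  sphere_int sigma (radial_extremal g b) t * (t ^+ n.-1)%:E = g t.
Proof.
move=> t0; have [r [r0 PE]] := Phi_fin t.
have T0 : (0 < t ^+ n.-1)%R by exact: exprn_gt0.
rewrite /sphere_int; under eq_integral => s /set_mem Ss.
  rewrite radial_extremal_scaled// EFinM muleA.
  over.
rewrite ge0_integralZl//; last 3 first.
- by apply: measurable_funTS; exact: (@measurable_scaled _ _ (EFin \o b) t mb').
- by move=> s _; exact: b0'.
- by rewrite mule_ge0// lee_fin invr_ge0 PE mulr_ge0// ltW.
rewrite -/(sphere_int sigma (EFin \o b) t) -/(Phi t) PE/= -!muleA -!EFinM.
by rewrite (mulrC r) mulVf ?mule1// gt_eqF// mulr_gt0.
Qed.

(** Where b^(1-p) = vr this is the equality case of Hoelder's inequality. A truncation only gives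
    b^(1-p) <= vr, hence b^p vr >= b, and the integral of [b] is [Phi t]. *)
Lemma sphere_int_radial_extremal_ge (vr : n.-tuple R -> R) (t : R) :
  measurable_fun setT vr ->
  (forall x, b x `^ (1 - p) <= vr x)%R -> (0 < t)%R ->
  g t `^ p * radial_weight b t <=
  sphere_int sigma (fun x => radial_extremal g b x `^ p * (vr x)%:E) t *
    (t ^+ n.-1)%:E.
Proof.
move=> mvr bvr t0; have [r [r0 PE]] := Phi_fin t.
have T0 : (0 < t ^+ n.-1)%R by exact: exprn_gt0.
have Tr0 : (0 < t ^+ n.-1 * r)%R by exact: mulr_gt0.
(* The p-th power of the ratio of the extremal function to [b], which is constant on the sphere of
   radius t. *)
pose c : \bar R := g t `^ p * ((t ^+ n.-1 * r)^-1 `^ p)%R%:E.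
have c0 : 0 <= c by rewrite mule_ge0 ?poweR_ge0// lee_fin powR_ge0.
apply: (@le_trans _ _ ((\int[sigma]_(s in S) (c * (b (scale_Rn t s))%:E)) *
    (t ^+ n.-1)%:E)).
  rewrite ge0_integralZl//; last 2 first.
  - by apply: measurable_funTS; exact: (@measurable_scaled _ _ (EFin \o b) t mb').
  - by move=> s _; exact: b0'.
  rewrite -/(sphere_int sigma (EFin \o b) t) -/(Phi t).
  rewrite /radial_weight -/(Phi t) PE poweR_EFin -EFinM -powR_jacobian//.
  rewrite -powRM ?(ltW r0) ?(ltW T0)// /c -!muleA -!EFinM.
  by rewrite [(r * t ^+ _)%R]mulrC powR_invM.
apply: lee_wpmul2r; first by rewrite lee_fin ltW.
apply: ge0_le_integral => //.
- by move=> s _; rewrite mule_ge0// b0'.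
- apply: emeasurable_funM => //.
  by apply: measurable_funTS; exact: (@measurable_scaled _ _ (EFin \o b) t mb').
- apply: measurable_funTS; apply: (@measurable_scaled _ _
    (fun x => radial_extremal g b x `^ p * (vr x)%:E)).
  apply: emeasurable_funM; last exact/measurable_EFinP.
  apply: (measurableT_comp (measurable_poweR _)).
  exact: measurable_radial_extremal.
move=> s Ss; rewrite radial_extremal_scaled// PE/= poweRM//; last first.
  by rewrite lee_fin mulr_ge0 ?invr_ge0// ltW.
rewrite poweR_EFin powRM ?invr_ge0 ?(ltW Tr0) ?(ltW (b0 _))// EFinM /c -!muleA.
rewrite lee_wpmul2l ?poweR_ge0// lee_wpmul2l ?lee_fin ?powR_ge0//.
rewrite -[leLHS](powR_split (b0 _)).
by rewrite ler_wpM2l ?powR_ge0.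
Qed.

End extremal.
End radial_reduction.

(** * Inner integrals as functions of their upper limit *)

Section inner_integrals.
Local Open Scope ereal_scope.
Context {R : realType}.
Implicit Types h : R -> \bar R.

Definition integral_to h (t : R) :=
  \int[@lebesgue_measure R]_(r in `]0%R, t[) h r.

Lemma integral_to_ge0 h t : (forall r, (0 < r)%R -> 0 <= h r) ->
  0 <= integral_to h t.
Proof.
move=> h0; apply: integral_ge0 => r /=.
by rewrite in_itv/= => /andP[r0 _]; exact: h0.
Qed.

Lemma nondecreasing_integral_to h :
  measurable_fun (setT : set (measurableTypeR R)) h ->
  (forall r, (0 < r)%R -> 0 <= h r) ->
  {homo integral_to h : s t / (s <= t)%R >-> s <= t}.
Proof.
move=> mh h0 s t st; apply: ge0_subset_integral => //.
- exact: measurable_funTS.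
- by move=> r; rewrite /= in_itv/= => /andP[r0 _]; exact: h0.
- by apply: subset_itvl; rewrite bnd_simp.
Qed.

Lemma measurable_integral_to h :
  measurable_fun (setT : set (measurableTypeR R)) h ->
  (forall r, (0 < r)%R -> 0 <= h r) ->
  measurable_fun (`]0%R, +oo[%classic : set (lebesgue_line R)) (integral_to h).
Proof.
move=> mh h0; apply: measurable_funTS.
exact: (completion_measurable_fun completion_line measurableT
  (nondecreasing_emeasurable (nondecreasing_integral_to mh h0))).
Qed.

Lemma le_integral_to h1 h2 t :
  measurable_fun (setT : set (measurableTypeR R)) h1 ->
  measurable_fun (setT : set (measurableTypeR R)) h2 ->
  (forall r, (0 < r)%R -> 0 <= h1 r) ->
  (forall r, (0 < r)%R -> h1 r <= h2 r) ->
  integral_to h1 t <= integral_to h2 t.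
Proof.
move=> mh1 mh2 h10 h12; apply: ge0_le_integral => //.
- by move=> r; rewrite /= in_itv/= => /andP[r0 _]; exact: h10.
- exact: measurable_funTS.
- exact: measurable_funTS.
- by move=> r; rewrite /= in_itv/= => /andP[r0 _]; exact: h12.
Qed.

Lemma eq_integral_to h1 h2 t :
  (forall r, (0 < r)%R -> h1 r = h2 r) -> integral_to h1 t = integral_to h2 t.
Proof.
move=> h12; apply: eq_integral => r; rewrite inE/= in_itv/= => /andP[r0 _].
exact: h12.
Qed.

Lemma cvg_integral_to (h_ : (R -> \bar R)^nat) h t :
  (forall k, measurable_fun (setT : set (measurableTypeR R)) (h_ k)) ->
  (forall k r, 0 <= h_ k r) ->
  (forall r, nondecreasing_seq (h_ ^~ r)) ->
  (forall r, h_ k r @[k --> \oo] --> h r) ->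
  integral_to (h_ k) t @[k --> \oo] --> integral_to h t.
Proof.
move=> mh h0 ndh hh; rewrite /integral_to (eq_integral
    (fun r : measurableTypeR R => limn (h_ ^~ r))); last first.
  by move=> r _; rewrite (cvg_lim _ (hh r)).
by apply: cvg_monotone_convergence => // k; exact: measurable_funTS.
Qed.

Lemma line_integral (G : lebesgue_line R -> \bar R) h t :
  measurable_fun (setT : set (measurableTypeR R)) h ->
  (forall r, (0 < r)%R -> 0 <= h r) ->
  {ae completed_lebesgue_measure, forall s : lebesgue_line R,
    (0 < (s : R))%R -> G s = h s} ->
  \int[completed_lebesgue_measure]_(s in `]0%R, t[) G s = integral_to h t.
Proof.
move=> mh h0 Gh; rewrite /integral_to.
rewrite -(completion_integral_ae completion_line (g := G))//.
- exact: measurable_funTS.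
- by move=> r; rewrite /= in_itv/= => /andP[r0 _]; exact: h0.
apply: filterS Gh => s + s0; apply.
by move: s0; rewrite /= in_itv/= => /andP[].
Qed.

(** The density of the image of the measure G dx under the Euclidean norm. *)
Definition sphere_density n (sigma : {measure set (n.-tuple R) -> \bar R})
  (G : n.-tuple R -> \bar R) (r : R) := sphere_int sigma G r * (r ^+ n.-1)%:E.

Lemma sphere_density_ge0 n (sigma : {measure set (n.-tuple R) -> \bar R}) G r :
  (forall x, 0 <= G x) -> (0 < r)%R -> 0 <= sphere_density sigma G r.
Proof.
by move=> G0 r0; rewrite mule_ge0 ?sphere_int_ge0// lee_fin exprn_ge0// ltW.
Qed.

Lemma measurable_sphere_density n (sigma : {measure set (n.-tuple R) -> \bar R})
    G : sphere_measure sigma -> measurable_fun setT G -> (forall x, 0 <= G x) ->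
  measurable_fun (setT : set (measurableTypeR R)) (sphere_density sigma G).
Proof.
move=> sphs mG G0; apply: emeasurable_funM.
  exact: (measurable_sphere_int sphs).
by apply/measurable_EFinP; exact: measurable_funX.
Qed.

Lemma ball_integral n (sigma : {measure set (n.-tuple R) -> \bar R})
    (G : lebesgue_space n R -> \bar R) (G' : n.-tuple R -> \bar R) t :
  sphere_measure sigma ->
  measurable_fun setT G' -> (forall x, 0 <= G' x) ->
  {ae completed_lebesgue_Rn, forall x : lebesgue_space n R, G x = G' x} ->
  \int[completed_lebesgue_Rn]_(s in open_ball0 t) G s =
  integral_to (sphere_density sigma G') t.
Proof.
move=> sphs mG' G'0 GG'; rewrite /integral_to -(polar_formula_ball sphs)//.
apply: (completion_integral_ae (completion_space n)) => //.
- exact: measurable_open_ball0.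
- exact: measurable_funTS.
by apply: filterS GG' => x ->.
Qed.

End inner_integrals.

(** * The two implications *)

Section equivalence.
Local Open Scope ereal_scope.
Context {R : realType} {n : nat}.
Variables p q theta C : R.
Variables u w : lebesgue_line R -> \bar R.
Variable v : lebesgue_space n R -> \bar R.
Variable sigma : {measure set (n.-tuple R) -> \bar R}.
Hypotheses (p0 : (0 < p)%R) (p1 : (p < 1)%R) (q0 : (0 < q)%R).
Hypothesis C0 : (0 <= C)%R.
Hypothesis wu : weight completed_lebesgue_measure `]0%R, +oo[ u.
Hypothesis wv : weight completed_lebesgue_Rn setT v.
Hypothesis sphs : sphere_measure sigma.

Let qp0 : (0 < q / p)%R. Proof. exact: divr_gt0. Qed.

Let Rpos : set (lebesgue_line R) := `]0%R, +oo[%classic.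

Let mRpos : measurable Rpos.
Proof. exact: (completion_preimage completion_line (A := `]0%R, +oo[%classic)). Qed.

Notation outer_integral := (weighted_integral completed_lebesgue_measure Rpos).

(** Changing [f] or [v] on a null set alters the inner integrals for no t, so they can be identified
    at every t and replaced by those of Borel versions. *)
Lemma ball_inequalityE (f : lebesgue_space n R -> \bar R) (F G : R -> \bar R) :
  (forall t : R, \int[completed_lebesgue_Rn]_(s in open_ball0 t)
     (f s `^ p * v s) = F t) ->
  (forall t : R, \int[completed_lebesgue_Rn]_(s in open_ball0 t) f s = G t) ->
  ball_inequality p q theta u w v C f =
  (outer_integral u (q / p) F `^ q^-1 <=
   C%:E * outer_integral w theta G `^ theta^-1).
Proof.
move=> FE GE; rewrite /ball_inequality; f_equal; f_equal.
  by apply: eq_integral => t _; rewrite FE.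
by f_equal; apply: eq_integral => t _; rewrite GE.
Qed.

Lemma line_inequalityE (sw g : lebesgue_line R -> \bar R) (F G : R -> \bar R) :
  (forall t : R, \int[completed_lebesgue_measure]_(s in `]0%R, t[)
     (g s `^ p * sw s) = F t) ->
  (forall t : R, \int[completed_lebesgue_measure]_(s in `]0%R, t[) g s = G t) ->
  line_inequality p q theta u w sw C g =
  (outer_integral u (q / p) F `^ q^-1 <=
   C%:E * outer_integral w theta G `^ theta^-1).
Proof.
move=> FE GE; rewrite /line_inequality; f_equal; f_equal.
  by apply: eq_integral => t _; rewrite FE.
by f_equal; apply: eq_integral => t _; rewrite GE.
Qed.

Lemma ball_inequality_from_line :
  (forall g : lebesgue_line R -> \bar R,
    nonneg_measurable (`]0%R, +oo[%classic : set (lebesgue_line R)) g ->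
    line_inequality p q theta u w (spherical_weight p sigma v) C g) ->
  forall f : lebesgue_space n R -> \bar R, nonneg_measurable setT f ->
    ball_inequality p q theta u w v C f.
Proof.
move=> line f [mf f0].
have [vr [mvr vr0 vvr]] := weight_representative wv.
have [f' [mf' f'0 ff']] :=
  completion_representative (completion_space n) mf (fun x => f0 x I).
pose g := sphere_density sigma f'.
have g0 (r : R) : (0 < r)%R -> 0 <= g r by exact: sphere_density_ge0.
have mg : measurable_fun (setT : set (measurableTypeR R)) g.
  exact: measurable_sphere_density.
pose b x := (vr x `^ (1 - p)^-1)%R.
have mb : measurable_fun setT b.
  by apply: (@measurableT_comp _ _ _ _ _ _ (@powR R ^~ _)).
have b0 x : (0 <= b x)%R by exact: powR_ge0.
pose h1 x := f' x `^ p * (vr x)%:E.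
have h10 x : 0 <= h1 x by rewrite mule_ge0 ?poweR_ge0// lee_fin ltW.
have mh1 : measurable_fun setT h1.
  apply: emeasurable_funM; last exact/measurable_EFinP.
  exact: (measurableT_comp (measurable_poweR _)).
pose k1 := sphere_density sigma h1.
have k10 (r : R) : (0 < r)%R -> 0 <= k1 r by exact: sphere_density_ge0.
have mk1 : measurable_fun (setT : set (measurableTypeR R)) k1.
  exact: measurable_sphere_density.
pose k2 r := g r `^ p * radial_weight p sigma b r.
have k20 (r : R) : (0 < r)%R -> 0 <= k2 r.
  by move=> _; rewrite mule_ge0 ?poweR_ge0// radial_weight_ge0.
have mk2 : measurable_fun (setT : set (measurableTypeR R)) k2.
  apply: emeasurable_funM; last exact: measurable_radial_weight.
  exact: (measurableT_comp (measurable_poweR _)).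
have := line g; rewrite (line_inequalityE (F := integral_to k2)
    (G := integral_to g)); last 2 first.
- move=> t; apply: line_integral => //.
  (* The two forms of the weight agree only for almost every radius, which suffices under the
     integral. *)
  have := completion_ae completion_line (spherical_weightE p sphs mvr vr0 vvr).
  by apply: filterS => s /[apply] ->.
- by move=> t; apply: line_integral => //; exact: aeW.
move=> /(_ _)/wrap[|lineg].
  split=> //.
    have := completion_measurable_fun completion_line measurableT mg.
    exact: measurable_funTS.
  by move=> r; rewrite /= in_itv/= andbT; exact: g0.
rewrite (ball_inequalityE (F := integral_to k1) (G := integral_to g)); last 2 first.
- move=> t; apply: (ball_integral (G' := h1) _ sphs) => //.
  by apply: filterS2 ff' vvr => x -> ->.
- by move=> t; exact: (ball_integral (G' := f') _ sphs).
apply: le_trans lineg.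
have mF1 := measurable_integral_to mk1 k10.
have mF2 := measurable_integral_to mk2 k20.
have k12 t : integral_to k1 t <= integral_to k2 t.
  by apply: le_integral_to => // r r0; exact: sphere_hoelder.
apply: le_poweR; first by rewrite invr_gt0.
  exact: (weighted_integral_ge0 _ mRpos wu mF1).
apply: (le_weighted_integral mRpos wu qp0 mF1 mF2) => // t.
exact: integral_to_ge0.
Qed.

Lemma line_inequality_from_ball :
  (forall f : lebesgue_space n R -> \bar R, nonneg_measurable setT f ->
    ball_inequality p q theta u w v C f) ->
  forall g : lebesgue_line R -> \bar R,
    nonneg_measurable (`]0%R, +oo[%classic : set (lebesgue_line R)) g ->
    line_inequality p q theta u w (spherical_weight p sigma v) C g.
Proof.
move=> ball g [mg g0].
have [vr [mvr vr0 vvr]] := weight_representative wv.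
(* Since [g] is controlled only on the half-line, it is extended by 0 before a Borel version is
   taken. *)
have [g' [mg' g'0 gg']] : exists g' : measurableTypeR R -> \bar R,
    [/\ measurable_fun setT g', forall x, 0 <= g' x &
    {ae completed_lebesgue_measure,
      forall s : lebesgue_line R, (g \_ Rpos) s = g' s}].
  apply: (completion_representative completion_line).
    exact/(measurable_restrictT _ mRpos).
  by move=> s; apply: erestrict_ge0.
have ggE : {ae completed_lebesgue_measure, forall s : lebesgue_line R,
    (0 < (s : R))%R -> g s = g' s}.
  apply: filterS gg' => s + s0; rewrite patchE mem_set//.
  by rewrite /Rpos/= in_itv/= s0.
have gpge0 r : 0 <= g' r `^ p by exact: poweR_ge0.
have mgp : measurable_fun (setT : set (measurableTypeR R)) (fun r => g' r `^ p).
  exact: (measurableT_comp (measurable_poweR _)).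
have p10 : (0 < 1 - p)%R by rewrite subr_gt0.
pose b x := (vr x `^ (1 - p)^-1)%R.
(* Truncation at k+1 rather than k keeps [c 0] positive. *)
pose c (k : nat) x := Num.min (vr x) k.+1%:R.
pose bk k x := (c k x `^ (1 - p)^-1)%R.
have c0 k x : (0 < c k x)%R by rewrite lt_min vr0 ltr0Sn.
have bk0 k x : (0 < bk k x)%R by exact: powR_gt0.
have b0 x : (0 <= b x)%R by exact: powR_ge0.
have mpow (h : n.-tuple R -> R) : measurable_fun setT h ->
    measurable_fun setT (fun x => (h x `^ (1 - p)^-1)%R).
  by move=> mh; apply: (@measurableT_comp _ _ _ _ _ _ (@powR R ^~ _)).
have mb : measurable_fun setT b by exact: mpow.
have mbk k : measurable_fun setT (bk k).
  by apply: (mpow (c k)); exact: measurable_minr.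
have le_pow x y : (0 < x)%R -> (x <= y)%R ->
    (x `^ (1 - p)^-1 <= y `^ (1 - p)^-1)%R.
  move=> x0 xy; apply: ge0_ler_powR => //.
  - by rewrite invr_ge0 ltW.
  - by rewrite nnegrE ltW.
  - by rewrite nnegrE ltW// (lt_le_trans x0 xy).
have bkK k x : (bk k x <= k.+1%:R `^ (1 - p)^-1)%R.
  by apply: le_pow => //; rewrite ge_min lexx orbT.
have bkv k x : (bk k x `^ (1 - p) <= vr x)%R.
  rewrite -powRrM mulVf ?gt_eqF// powRr1; last exact: ltW.
  by rewrite ge_min lexx.
have ndbk x : {homo bk ^~ x : k m / (k <= m)%N >-> (k <= m)%R}.
  move=> k m km; apply: le_pow => //.
  by rewrite le_min !ge_min lexx/= ler_nat ltnS km orbT.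
(* [vr x] is real, so the sequence is stationary once k+1 exceeds it. *)
have bkb x : bk k x @[k --> \oo] --> b x.
  apply: cvg_near_cst; near=> k; rewrite /bk /c min_l//.
  near: k; exists (Num.truncn (vr x)) => // k /= vk.
  by apply: (le_trans (ltW (truncnS_gt _))); rewrite ler_nat ltnS.
have bkb' x : (bk k x)%:E @[k --> \oo] --> (b x)%:E.
  by apply: cvg_EFin; [exact: nearW|exact: bkb].
pose Phi k r := sphere_int sigma (EFin \o bk k) r.
have mS := @measurable_unit_sphere R n.
have mbs k r : measurable_fun (@unit_sphere R n)
    (fun s => (bk k (scale_Rn r s))%:E).
  apply: measurable_funTS; apply: (@measurable_scaled _ _ (EFin \o bk k)).
  exact/measurable_EFinP.
have ndPhi r : nondecreasing_seq (Phi ^~ r).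
  move=> k m km; apply: (ge0_le_integral _ mS); [|exact: mbs|exact: mbs|].
    by move=> s _; rewrite lee_fin ltW.
  by move=> s _; rewrite lee_fin ndbk.
have Phi0 k r : 0 <= Phi k r.
  by apply: sphere_int_ge0 => x; rewrite lee_fin ltW.
have cvgPhi r : Phi k r @[k --> \oo] --> sphere_int sigma (EFin \o b) r.
  rewrite /sphere_int (eq_integral
    (fun s => limn (fun k => (bk k (scale_Rn r s))%:E))); last first.
    by move=> s _; rewrite (cvg_lim _ (bkb' _)).
  apply: cvg_monotone_convergence => //.
  - by move=> k; exact: mbs.
  - by move=> k s _; rewrite lee_fin ltW.
  - by move=> s _ k m km; rewrite lee_fin ndbk.
pose W k := radial_weight p sigma (bk k).
have W0 k r : 0 <= W k r by exact: radial_weight_ge0.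
have ndW r : nondecreasing_seq (W ^~ r).
  move=> k m km; apply: lee_wpmul2r; first by rewrite lee_fin powR_ge0.
  exact: (le_poweR p10 (Phi0 k r) (ndPhi r k m km)).
have cvgW r : W k r @[k --> \oo] --> radial_weight p sigma b r.
  apply: cvgeZr => //.
  exact: (cvg_poweR_nondecreasing p10 (Phi0 ^~ r) (ndPhi r) (cvgPhi r)).
have mW k : measurable_fun (setT : set (measurableTypeR R)) (W k).
  by apply: measurable_radial_weight => // x; exact: ltW.
pose K k r := g' r `^ p * W k r.
pose Kb r := g' r `^ p * radial_weight p sigma b r.
have mK k : measurable_fun (setT : set (measurableTypeR R)) (K k).
  exact: emeasurable_funM.
have K0 k r : 0 <= K k r by exact: mule_ge0.
have ndK r : nondecreasing_seq (K ^~ r).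
  by move=> k m km; apply: lee_wpmul2l; [exact: gpge0|exact: ndW].
(* Both [g' r] and the limit weight may be +oo, so convergence of the product relies on monotonicity
   in k. *)
have cvgK r : K k r @[k --> \oo] --> Kb r.
  exact: (cvgeMl_nondecreasing (gpge0 r) (W0 ^~ r) (ndW r) (cvgW r)).
have mKb : measurable_fun (setT : set (measurableTypeR R)) Kb.
  by apply: emeasurable_funM => //; exact: measurable_radial_weight.
have Kb0 r : 0 <= Kb r by rewrite mule_ge0// radial_weight_ge0.
rewrite (line_inequalityE (F := integral_to Kb) (G := integral_to g')); last 2 first.
- move=> t; apply: line_integral => //.
  have := completion_ae completion_line (spherical_weightE p sphs mvr vr0 vvr).
  by apply: filterS2 ggE => s gs ws s0; rewrite gs// ws.
- by move=> t; exact: line_integral.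
set B := C%:E * _.
have B0 : 0 <= B by rewrite mule_ge0 ?poweR_ge0.
have mGb := measurable_integral_to mKb (fun r _ => Kb0 r).
(* The root 1/q is removed first, so that monotone convergence applies to the outer integral
   itself. *)
suff KB : outer_integral u (q / p) (integral_to Kb) <= B `^ q.
  rewrite -[leRHS](poweRe1 B0) -(@mulfV _ q) ?gt_eqF// poweRrM.
  apply: le_poweR; [by rewrite invr_gt0| |exact: KB].
  exact: (weighted_integral_ge0 _ mRpos wu mGb).
apply: (weighted_integral_lim_le mRpos wu qp0
    (F := fun k => integral_to (K k)) (G := integral_to Kb)).
- by move=> k; exact: (measurable_integral_to (mK k) (fun r _ => K0 k r)).
- exact: mGb.
- by move=> k t; exact: (integral_to_ge0 _ (fun r _ => K0 k r)).
- move=> t k m km.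
  exact: (le_integral_to _ (mK k) (mK m) (fun r _ => K0 k r)
    (fun r _ => ndK r k m km)).
- by move=> t; exact: (cvg_integral_to mK K0 ndK cvgK).
move=> k; pose f := radial_extremal sigma g' (bk k).
have mf : measurable_fun setT f.
  exact: (measurable_radial_extremal sphs mg' (mbk k) (bk0 k)).
have f0 x : 0 <= f x by exact: radial_extremal_ge0.
pose h x := f x `^ p * (vr x)%:E.
have h0 x : 0 <= h x by rewrite mule_ge0 ?poweR_ge0// lee_fin ltW.
have mh : measurable_fun setT h.
  apply: emeasurable_funM; last exact/measurable_EFinP.
  exact: (measurableT_comp (measurable_poweR _)).
have := ball f; rewrite (ball_inequalityE
    (F := integral_to (sphere_density sigma h)) (G := integral_to g')); last 2 first.
- move=> t; apply: (ball_integral (G' := h) _ sphs) => //.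
  by apply: filterS vvr => x ->.
- move=> t; rewrite (ball_integral (G' := f) _ sphs)//; last exact: aeW.
  apply: eq_integral_to => r r0.
  exact: (sphere_int_radial_extremal sphs g'0 (mbk k) (bk0 k) (bkK k) r0).
move=> /(_ _)/wrap[|ballf].
  split; last by move=> x _; exact: f0.
  exact: (completion_measurable_fun (completion_space n) measurableT mf).
have mL := measurable_sphere_density sphs mh h0.
have L0 r (r0 : (0 < r)%R) := sphere_density_ge0 sigma h0 r0.
have mFL := measurable_integral_to mL L0.
have KL r (r0 : (0 < r)%R) : K k r <= sphere_density sigma h r :=
  sphere_int_radial_extremal_ge sphs mg' g'0 (mbk k) (bk0 k) (bkK k) mvr (bkv k) r0.
have KLt t : integral_to (K k) t <= integral_to (sphere_density sigma h) t :=
  le_integral_to _ (mK k) mL (fun r _ => K0 k r) KL.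
apply: (le_trans (le_weighted_integral mRpos wu qp0 _ mFL _ KLt)).
- exact: (measurable_integral_to (mK k) (fun r _ => K0 k r)).
- by move=> t; exact: (integral_to_ge0 _ (fun r _ => K0 k r)).
(* Writing the outer integral W as (W^(1/q))^q, the claim is the ball inequality for [f] raised to
   the power q. *)
have W1 := weighted_integral_ge0 (q / p)%R mRpos wu mFL.
rewrite -[leLHS](poweRe1 W1) -(@mulVf _ q) ?gt_eqF// poweRrM.
by apply: le_poweR => //; exact: poweR_ge0.
Unshelve. all: by end_near. Qed.

End equivalence.

Theorem theorem2p1 (R : realType) (n : nat) (p q theta : R)
  (u w : lebesgue_line R -> \bar R) (v : lebesgue_space n R -> \bar R)
  (sigma : {measure set (n.-tuple R) -> \bar R}) :
  (1 <= n)%N -> 0 < p -> p < 1 -> 0 < q -> 0 < theta ->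
  weight completed_lebesgue_measure `]0, +oo[ u ->
  weight completed_lebesgue_measure `]0, +oo[ w ->
  weight completed_lebesgue_Rn setT v ->
  sphere_measure sigma ->
  ((exists C, ball_constants p q theta u w v C) <->
   (exists C', line_constants p q theta u w (spherical_weight p sigma v) C')) /\
  best_constant (ball_constants p q theta u w v) =
  best_constant (line_constants p q theta u w (spherical_weight p sigma v)).
Proof.
move=> _ p0 p1 q0 _ wu _ wv sphs.
suff -> : ball_constants p q theta u w v =
    line_constants p q theta u w (spherical_weight p sigma v) by [].
apply/seteqP; split=> C [C0 ineq]; split=> //.
  exact: (line_inequality_from_ball p0 p1 q0 C0 wu wv sphs ineq).
exact: (ball_inequality_from_line p0 p1 q0 wu wv sphs ineq).
Qed.
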